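(* Let $X$ be a polyhedral Banach space and let $Y$ be a subspace of $X$ (with the norm inherited from $X$). Then \[ sm(B_{Y^*}) = \{ f \in Y^* : f = \widetilde{f}|_Y \text{ for some } \widetilde{f} \in sm(B_{X^*}) \text{ with } \|\widetilde{f}|_Y\| = 1 \} \] if and only if $ext(B_Y) \subset ext(B_X)$.
   Context: All spaces are real and finite-dimensional. For a normed space $Z$, $B_Z$ and $S_Z$ denote the closed unit ball and the unit sphere, $Z^*$ is the dual space with the dual norm, and $ext(B_Z)$ is the set of extreme points of $B_Z$. A polyhedral Banach space is a finite-dimensional real Banach space $X$ such that $B_X$ is a polyhedron; equivalently, $ext(B_X)$ is finite. A point $z \in S_Z$ is smooth if there is exactly one $\varphi \in S_{Z^*}$ with $\varphi(z) = 1$; $sm(B_Z)$ denotes the set of all smooth points lying in $S_Z$. Thus $sm(B_{Z^*})$ is the set of norm-one functionals on $Z$ that are smooth points of the normed space $Z^*$. The norm $\|\widetilde{f}|_Y\|$ is the norm in $Y^*$.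
   Formalization: The subspace Y is assumed to be nonzero: for Y = {0} and X ≠ {0} both sets of functionals are empty, hence equal, while ext(B_Y) = {0} is not contained in ext(B_X), so the stated equivalence fails. *)

(* Defs.v *)
From HB Require Import structures.
From mathcomp Require Import all_boot all_order all_algebra.
From mathcomp Require Import all_classical all_reals all_analysis.

Set Implicit Arguments.
Unset Strict Implicit.
Unset Printing Implicit Defensive.

Import Order.TTheory GRing.Theory Num.Theory.
Import numFieldNormedType.Exports.

Local Open Scope classical_set_scope.
Local Open Scope ring_scope.

(* Completeness is automatic in finite dimension, so these are exactly the
   finite-dimensional real Banach spaces. *)
#[short(type="finNormedModType")]
HB.structure Definition FinNormedModule (R : realType) :=
  {V of NormedModule R V & Vector R V}.

Section Subspace.
Context {R : realType} {X : finNormedModType R} (Y : {vspace X}).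
Implicit Types x y : subvs_of Y.

Let subvs_norm x : R := `|vsval x|.

Let subvs_ler_normD x y : subvs_norm (x + y) <= subvs_norm x + subvs_norm y.
Proof. by rewrite /subvs_norm linearD ler_normD. Qed.

Let subvs_normrZ (l : R) x : subvs_norm (l *: x) = `|l| * subvs_norm x.
Proof. by rewrite /subvs_norm linearZ/= normrZ. Qed.

Let subvs_normr0_eq0 x : subvs_norm x = 0 -> x = 0.
Proof. by move=> /normr0_eq0 x0; apply: val_inj; rewrite /= x0. Qed.

HB.instance Definition _ := Lmodule_isNormed.Build R (subvs_of Y)
  subvs_ler_normD subvs_normrZ subvs_normr0_eq0.

End Subspace.

Section UnitBall.
Context {R : realType} (Z : normedModType R).

Definition unit_ball : set Z := [set z | `|z| <= 1].

Definition unit_sphere : set Z := [set z | `|z| = 1].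

End UnitBall.
Arguments unit_ball {R} Z.
Arguments unit_sphere {R} Z.

Section LinearFormBounded.
Import VectorInternalTheory.
Context {R : realType} (X : finNormedModType R).

Local Notation n := (dim X).
Local Notation r2v := (@r2v R X).
Local Notation v2r := (@v2r R X).

Let norm_r2v_le : exists K : R, forall u : 'rV[R]_n,
  `|r2v u| <= K * `|u|.
Proof.
exists (\sum_(i < n) `|r2v (delta_mx 0 i)|) => u.
rewrite {1}(row_sum_delta u) linear_sum/= mulr_suml.
apply: (le_trans (ler_norm_sum _ _ _)); apply: ler_sum => i _.
rewrite linearZ/= normrZ mulrC ler_wpM2l//.
rewrite [leRHS]/Num.norm/= mx_normE.
exact: (le_bigmax _ (fun i => `|u i.1 i.2|%:nng) (0, i)).
Qed.

Let norm_v2r_le : exists K : R, forall x : X, `|v2r x| <= K * `|x|.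
Proof.
have [K r2vB] := norm_r2v_le.
have r2v_cont : continuous r2v.
  apply/linear_bounded_continuous/linear_boundedP.
  near=> r => u; apply: (le_trans (r2vB u)).
  by rewrite ler_wpM2r//; near: r; exact: nbhs_pinfty_ge.
pose S := [set u : 'rV[R]_n | `|u| = 1].
have compactS : compact S.
  apply: bounded_closed_compact.
    by exists 1; split=> // M /ltW M1 u /= ->.
  rewrite (_ : S = Num.norm @^-1` [set 1 : R])//.
  by apply: closed_comp => [u _|]; [exact: norm_continuous|exact: closed_eq].
have [S0|/set0P S0] := eqVneq S set0.
  exists 0 => x; rewrite mul0r normr_le0; apply/negPn/negP => x0.
  have /eqP/negPn/negP := S0; apply; apply/set0P; exists (`|v2r x|^-1 *: v2r x).
  by rewrite /S/= normrZ normfV normr_id mulVf// normr_eq0.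
have [|c Sc cmin] :=
    @compact_EVT_min _ R (fun u : 'rV[R]_n => `|r2v u|) S S0 compactS.
  apply: continuous_subspaceT => u.
  by apply: continuous_comp; [exact: r2v_cont|exact: norm_continuous].
have c_gt0 : 0 < `|r2v c|.
  rewrite normr_gt0; apply/eqP => /(congr1 v2r); rewrite r2vK linear0 => c0.
  by move: Sc; rewrite inE /S/= c0 normr0 => /esym/eqP; rewrite oner_eq0.
exists `|r2v c|^-1 => x; rewrite ler_pdivlMl//.
have [->|x0] := eqVneq (v2r x) 0; first by rewrite normr0 mulr0.
have vx0 : 0 < `|v2r x| by rewrite normr_gt0.
have /cmin : `|v2r x|^-1 *: v2r x \in S.
  by rewrite inE /S/= normrZ normfV normr_id mulVf// gt_eqF.
by rewrite linearZ/= v2rK normrZ normfV normr_id mulrC ler_pdivlMr.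
Unshelve. all: by end_near. Qed.

Lemma linear_form_bounded (f : 'Hom(X, R^o)) :
  exists K : R, forall x, `|f x| <= K * `|x|.
Proof.
have [K v2rB] := norm_v2r_le.
pose C : R := \sum_(i < n) `|f (r2v (delta_mx 0 i))|.
exists (C * K) => x.
rewrite -mulrA; apply: le_trans (ler_wpM2l _ (v2rB x)); last first.
  exact: sumr_ge0.
rewrite -{1}[x]v2rK {1}(row_sum_delta (v2r x)).
rewrite !linear_sum/= mulr_suml.
apply: (le_trans (ler_norm_sum _ _ _)); apply: ler_sum => i _.
rewrite !linearZ/= normrM mulrC ler_wpM2l//.
rewrite [leRHS]/Num.norm/= mx_normE.
exact: (le_bigmax _ (fun i => `|v2r x i.1 i.2|%:nng) (0, i)).
Qed.

End LinearFormBounded.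

Definition dual_space {R : realType} (X : finNormedModType R) : Type :=
  'Hom(X, R^o).

Section Dual.
Context {R : realType} (X : finNormedModType R).

HB.instance Definition _ := Vector.copy (dual_space X) 'Hom(X, R^o).

Implicit Types f g : dual_space X.

Definition dual_norm f : R := sup [set `|f x| | x in unit_ball X].

Let dual_norm_has_sup f : has_sup [set `|f x| | x in unit_ball X].
Proof.
split; first by exists `|f 0|, 0 => //; rewrite /unit_ball/= normr0.
have [K fK] := linear_form_bounded f.
exists `|K| => _ [x x1 <-]; apply: (le_trans (fK x)).
apply: (le_trans (ler_norm _)); rewrite normrM normr_id.
by rewrite ler_piMr.
Qed.

Lemma dual_norm_ge f x : unit_ball X x -> `|f x| <= dual_norm f.
Proof. by move=> x1; apply: ub_le_sup; [case: (dual_norm_has_sup f)|exists x]. Qed.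

Lemma dual_norm_le f (C : R) :
  (forall x, unit_ball X x -> `|f x| <= C) -> dual_norm f <= C.
Proof.
move=> fC; apply: ge_sup; first by case: (dual_norm_has_sup f).
by move=> _ [x x1 <-]; exact: fC.
Qed.

Let dual_ler_normD f g : dual_norm (f + g) <= dual_norm f + dual_norm g.
Proof.
apply: dual_norm_le => x x1; rewrite add_lfunE.
by rewrite (le_trans (ler_normD _ _))// lerD// dual_norm_ge.
Qed.

Let dual_normrZ_le (l : R) f : dual_norm (l *: f) <= `|l| * dual_norm f.
Proof.
apply: dual_norm_le => x x1; rewrite scale_lfunE normrM.
by rewrite ler_wpM2l// dual_norm_ge.
Qed.

Let dual_normrZ (l : R) f : dual_norm (l *: f) = `|l| * dual_norm f.
Proof.
apply/eqP; rewrite eq_le dual_normrZ_le/=.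
have [->|l0] := eqVneq l 0.
  rewrite normr0 mul0r scale0r; apply: le_trans (@dual_norm_ge 0 0 _) => //.
  by rewrite /unit_ball/= normr0.
rewrite -ler_pdivlMl ?normr_gt0// -normfV.
by apply: le_trans (dual_normrZ_le _ _); rewrite scalerA mulVf// scale1r.
Qed.

Let dual_normr0_eq0 f : dual_norm f = 0 -> f = 0.
Proof.
move=> f0; apply/lfunP => x; rewrite zero_lfunE.
have [->|x0] := eqVneq x 0; first by rewrite linear0.
have /dual_norm_ge : unit_ball X (`|x|^-1 *: x).
  by rewrite /unit_ball/= normrZ normfV normr_id mulVf// normr_eq0.
move=> /(_ f); rewrite f0 normr_le0 linearZ/= => /eqP/eqP.
by rewrite scaler_eq0 invr_eq0 normr_eq0 (negbTE x0)/= => /eqP.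
Qed.

HB.instance Definition _ := Lmodule_isNormed.Build R (dual_space X)
  dual_ler_normD dual_normrZ dual_normr0_eq0.

End Dual.

Definition dual_restrict {R : realType} {X : finNormedModType R} (Y : {vspace X})
  (f : dual_space X) : dual_space (subvs_of Y) := (f \o linfun vsval)%VF.

Section Geometry.
Context {R : realType} (Z : finNormedModType R).

Definition extreme_points (A : set Z) : set Z :=
  [set z | A z /\ forall a b (t : R), A a -> A b -> 0 < t < 1 ->
     z = t *: a + (1 - t) *: b -> a = z /\ b = z].

Definition smooth_points : set Z :=
  [set z | unit_sphere Z z /\
     exists! phi : dual_space Z, unit_sphere (dual_space Z) phi /\ phi z = 1].

(* A polyhedron is the solution set of a finite system of linear inequalities;
   the null functional only contributes trivial or unsatisfiable ones. *)
Definition polyhedron (A : set Z) : Prop :=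
  exists s : seq (dual_space Z * R),
    A = [set z | forall p, p \in s -> p.1 z <= p.2].

Definition polyhedral : Prop := polyhedron (unit_ball Z).

End Geometry.
Arguments smooth_points {R} Z.
Arguments polyhedral {R} Z.

(* Main.v *)
Require Import Defs.
From HB Require Import structures.
From mathcomp Require Import all_boot all_order all_algebra.
From mathcomp Require Import all_classical all_reals all_analysis.
From mathcomp Require Import ring lra.

Set Implicit Arguments.
Unset Strict Implicit.
Unset Printing Implicit Defensive.

Import Order.TTheory GRing.Theory Num.Theory.
Import numFieldNormedType.Exports.

Local Open Scope classical_set_scope.
Local Open Scope ring_scope.

(** A functional [F] on a finite-dimensional space [Z] is a smooth point of
    [B_{Z*}] exactly when it exposes a point of [B_Z]: it has norm one and
    attains its norm at a single point of [B_Z] ([smooth_dualP]). Indeed [Z] is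
    reflexive ([reflexivity], [norm_eval_at]), so the norm-one functionals on
    [Z*] taking the value 1 at [F] are the evaluations at the points where [F]
    attains its norm. The theorem thus compares the functionals exposing points
    of [B_Y] with the restrictions of those exposing points of [B_X].

    If [F] exposes [x] in [B_X] and its restriction to [Y] still has norm one,
    the restriction attains its norm on [B_Y], necessarily at [x], and hence
    exposes [x] in [B_Y] ([exposes_restrict]). So one inclusion between the two
    sets of functionals always holds.

    Suppose the two sets are equal and let [y] be extreme in [B_Y]. As [B_Y] is
    a polyhedron, some [f] exposes [y] ([extreme_exposes]). This [f] is the
    restriction of a functional exposing a point of [B_X], which can only be
    [y]; hence [y] is extreme in [B_X] ([exposes_extreme]).

    Conversely, suppose that the extreme points of [B_Y] are extreme in [B_X],
    and let [f] expose [y] in [B_Y]. Then some [G] exposes [y] in [B_X]. In a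
    polyhedron, a functional exposing [y] can be perturbed slightly and still be
    maximal at [y] ([exposes_perturb]): it is negative on the nonzero vectors of
    the cone of directions allowed by the constraints active at [y], and this
    cone has a compact base. So for some [e > 0] the functional [f - e G|_Y]
    has norm at most [1 - e], its value at [y]. By Hahn-Banach it extends to
    some [H] on [X] with the same bound, and [F = H + e G] extends [f], has norm
    one, and attains its norm only where [G] does, that is, at [y]. *)

(** * Functionals and the dual norm *)

Section DualBasics.
Context {R : realType} (Z : finNormedModType R).
Implicit Types (f g : dual_space Z) (z w : Z).

Lemma dual_addE f g z : (f + g) z = f z + g z :> R.
Proof. exact: add_lfunE. Qed.

Lemma dual_scaleE (a : R) f z : (a *: f) z = a * f z :> R.
Proof. exact: scale_lfunE. Qed.

Lemma dual_le f z : (f z : R) <= `|f| * `|z|.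
Proof.
have [->|z0] := eqVneq z 0; first by rewrite linear0 normr0 mulr0.
have nz : 0 < `|z| by rewrite normr_gt0.
have := @dual_norm_ge _ _ f (`|z|^-1 *: z).
rewrite /unit_ball/= normrZ normfV normr_id mulVf ?gt_eqF// => /(_ (lexx _)).
rewrite linearZ/= normrM gtr0_norm ?invr_gt0// ler_pdivrMl// mulrC.
exact/le_trans/ler_norm.
Qed.

Lemma dual_norm_le_ball f (c : R) : (forall w, `|w| <= 1 -> (f w : R) <= c) ->
  `|f| <= c.
Proof.
move=> fc; apply: dual_norm_le => x x1; rewrite ler_norml fc// andbT lerNl.
by have := fc (- x); rewrite normrN linearN; exact.
Qed.

(** Homogeneity: a bound on the unit ball is a bound by a multiple of the norm. *)
Lemma dual_ball_le f (c : R) z : (forall w, `|w| <= 1 -> (f w : R) <= c) ->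
  (f z : R) <= c * `|z|.
Proof.
move=> fc; apply: (le_trans (dual_le f z)).
by rewrite ler_wpM2r//; exact: dual_norm_le_ball.
Qed.

Lemma exists_dual_neq0 z : z != 0 -> exists f, (f z : R) != 0.
Proof.
move=> z0; apply: contrapT => /forallNP f0; move/eqP: z0; apply.
have zB : z \in <<vbasis {:Z}>>%VS by rewrite (span_basis (vbasisP _)) memvf.
rewrite (coord_span zB) big1// => i _.
have := f0 (linfun (coord (vbasis {:Z}) i : Z -> R^o)).
by move=> /negP/negPn/eqP; rewrite lfunE/= => ->; rewrite scale0r.
Qed.

End DualBasics.

(** * The Hahn-Banach theorem *)

Section HahnBanach.
Context {R : realType} (Z : finNormedModType R).
Implicit Types (f : dual_space Z) (z w v : Z) (U : {vspace Z}).

(** A functional vanishing on [U] and equal to 1 at a given point off [U]. *)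
Lemma exists_separating U v : v \notin U ->
  exists h : dual_space Z, (forall u, u \in U -> h u = 0) /\ h v = 1 :> R.
Proof.
move=> vU; have w0 : v - projv U v != 0.
  by apply: contra vU; rewrite subr_eq0 => /eqP ->; exact: memv_proj.
have [f fw] := exists_dual_neq0 w0.
exists ((f (v - projv U v))^-1 *: (f \o (\1 - projv U))%VF : dual_space Z).
split=> [u uU|]; rewrite dual_scaleE comp_lfunE add_lfunE opp_lfunE id_lfunE.
  by rewrite (projv_id uU) subrr linear0 mulr0.
by rewrite mulVf.
Qed.

(** Extension of a norm bound from [U] to the span of [U] and one more vector. *)
Lemma hahn_banach_step f (c : R) U v : 0 <= c -> v \notin U ->
  (forall u, u \in U -> (f u : R) <= c * `|u|) ->
  exists g : dual_space Z, (forall u, u \in U -> g u = f u) /\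
    (forall w, w \in (U + <[v]>)%VS -> (g w : R) <= c * `|w|).
Proof.
move=> c0 vU fc; have [h [hU hv]] := exists_separating vU.
pose S : set R := [set f u - c * `|u - v| | u in [set u | u \in U]].
have Sub u' : u' \in U -> ubound S (c * `|u' + v| - f u').
  move=> u'U _ [u /= uU <-]; rewrite lerBrDr addrAC lerBlDr -linearD -mulrDr.
  apply: (le_trans (fc _ (memvD uU u'U))); rewrite ler_wpM2l//.
  have -> : u + u' = (u' + v) + (u - v) by rewrite addrACA subrr addr0 addrC.
  exact: ler_normD.
have S0 : S !=set0 by exists (f 0 - c * `|0 - v|), 0 => //=; exact: mem0v.
have supS u : u \in U -> f u - c * `|u - v| <= sup S.
  move=> uU; apply: ub_le_sup; last by exists u.
  by exists (c * `|0 + v| - f 0); exact: Sub (mem0v _).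
have Ssup u : u \in U -> sup S <= c * `|u + v| - f u.
  by move=> uU; apply: ge_sup => //; exact: Sub.
(* The correction by [h] leaves [f] unchanged on [U] and moves the value at
   [v] to [sup S], the least one compatible with the bound on [U - v]. *)
exists (f + (sup S - f v) *: h); split=> [u uU|w].
  by rewrite dual_addE dual_scaleE hU// mulr0 addr0.
move=> /memv_addP [u uU [_ /vlineP [t ->] ->]].
have -> : (f + (sup S - f v) *: h) (u + t *: v) = f u + t * sup S :> R.
  rewrite dual_addE dual_scaleE !linearD !linearZ/= hU// hv add0r.
  by rewrite /GRing.scale/= mulr1; lra.
have [t0|t0|->] := ltgtP t 0; last by rewrite scale0r addr0 mul0r addr0 fc.
- have nt0 : 0 < - t by rewrite oppr_gt0.
  have := supS _ (memvZ (- t)^-1 uU).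
  have -> : (- t)^-1 *: u - v = (- t)^-1 *: (u + t *: v).
    by rewrite scalerDr scalerA invrN mulNr mulVf ?lt_eqF// scaleN1r.
  rewrite linearZ/= normrZ gtr0_norm ?invr_gt0// mulrCA -mulrBr ler_pdivrMl//.
  lra.
- have := Ssup _ (memvZ t^-1 uU).
  have -> : t^-1 *: u + v = t^-1 *: (u + t *: v).
    by rewrite scalerDr scalerA mulVf ?gt_eqF// scale1r.
  rewrite linearZ/= normrZ gtr0_norm ?invr_gt0// mulrCA -mulrBr ler_pdivlMl//.
  lra.
Qed.

(** Hahn-Banach, by induction on the codimension of [U]; the functional to be
    extended from [U] is given as the restriction of a functional on the whole
    space. *)
Lemma hahn_banach f (c : R) U : 0 <= c ->
  (forall u, u \in U -> (f u : R) <= c * `|u|) ->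
  exists g : dual_space Z, (forall u, u \in U -> g u = f u) /\
    (forall w, (g w : R) <= c * `|w|).
Proof.
move=> c0; have [n] := ubnP (\dim {:Z} - \dim U).
elim: n => // n IH in f U *; rewrite ltnS => dU fc.
have [UZ|UZ] := eqVneq U fullv.
  by exists f; split=> // w; apply: fc; rewrite UZ memvf.
have [v vU] : exists v, v \notin U.
  apply: contrapT => /forallNP vU; move/eqP: UZ; apply; apply/eqP.
  rewrite eqEsubv subvf/=; apply/subvP => v _; exact/negPn/negP/vU.
have [g [gf gc]] := hahn_banach_step c0 vU fc.
have [|g' [g'g g'c]] := IH g (U + <[v]>)%VS _ gc.
  apply: leq_trans dU; apply: ltn_sub2l.
    rewrite (ltn_leqif (dimv_leqif_sup (subvf U))).
    by apply: contra vU => /subvP; apply; rewrite memvf.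
  rewrite (ltn_leqif (dimv_leqif_sup (addvSl _ _))).
  by rewrite subv_add subvv/= -memvE.
exists g'; split=> // u uU; rewrite g'g ?gf//.
exact: (subvP (addvSl U <[v]>%VS)).
Qed.

Lemma exists_norming z :
  exists f : dual_space Z, `|f| <= 1 /\ f z = `|z| :> R.
Proof.
have [->|z0] := eqVneq z 0.
  by exists 0; rewrite normr0 ler01 linear0 normr0.
have [f fz] := exists_dual_neq0 z0.
have [||g [gf gc]] := @hahn_banach ((`|z| / f z) *: f) 1 <[z]>%VS.
- exact: ler01.
- move=> _ /vlineP [a ->]; rewrite dual_scaleE linearZ/= mul1r normrZ.
  by rewrite mulrCA divfK// ler_wpM2r// ler_norm.
exists g; split; last by rewrite gf ?memv_line// dual_scaleE divfK.
by apply: dual_norm_le_ball => w w1; rewrite (le_trans (gc w))// mul1r.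
Qed.

End HahnBanach.

(** * Reflexivity *)

Section Bidual.
Context {R : realType} (Z : finNormedModType R).
Implicit Types (f : dual_space Z) (z w : Z).

Fact eval_at_is_linear z :
  linear ((fun f : dual_space Z => f z) : dual_space Z -> R^o).
Proof. by move=> a f g; rewrite dual_addE dual_scaleE. Qed.

(** The canonical image of a point in the bidual. *)
Definition eval_at z : dual_space (dual_space Z) :=
  linfun ((fun f : dual_space Z => f z) : dual_space Z -> R^o).

Lemma eval_atE z f : eval_at z f = f z :> R.
Proof.
pose L := GRing.isLinear.Build _ _ _ _ _ (eval_at_is_linear z).
pose e : {linear dual_space Z -> R^o} :=
  HB.pack (fun f : dual_space Z => f z : R^o) L.
exact: (lfunE e).
Qed.

Lemma norm_eval_at z : `|eval_at z| = `|z|.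
Proof.
apply/eqP; rewrite eq_le; apply/andP; split.
  apply: dual_norm_le_ball => f f1; rewrite eval_atE (le_trans (dual_le _ _))//.
  by rewrite ler_piMl.
have [f [f1 <-]] := exists_norming z.
by rewrite -eval_atE (le_trans (dual_le _ _))// ler_piMr.
Qed.

Lemma eval_at_inj : injective eval_at.
Proof.
move=> z w zw; apply/eqP; rewrite -subr_eq0 -normr_le0.
have [f [_ <-]] := exists_norming (z - w).
by rewrite linearB/= -!eval_atE zw subrr.
Qed.

Lemma reflexivity (phi : dual_space (dual_space Z)) : exists z, phi = eval_at z.
Proof.
pose b := vbasis {:Z}.
pose c i : dual_space Z := linfun (coord b i : Z -> R^o).
(* The coordinates of the preimage are the values of [phi] at the coordinate
   functionals of a basis. *)
exists (\sum_(i < \dim {:Z}) (phi (c i) : R) *: b`_i); apply/lfunP => f.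
rewrite eval_atE linear_sum/=.
have {1}-> : f = \sum_(i < \dim {:Z}) (f b`_i : R) *: c i.
  apply/lfunP => z.
  have zB : z \in <<b>>%VS by rewrite (span_basis (vbasisP _)) memvf.
  rewrite [in LHS](coord_span zB) linear_sum/= sum_lfunE; apply: eq_bigr => i _.
  by rewrite linearZ/= dual_scaleE lfunE/= mulrC.
rewrite linear_sum/=; apply: eq_bigr => i _.
by rewrite !linearZ/= [RHS]mulrC.
Qed.

(** A norming functional of [f] in the bidual is the evaluation at a point where
    [f] attains its norm. *)
Lemma norm_attained f : `|f| = 1 -> exists z, `|z| = 1 /\ f z = 1 :> R.
Proof.
move=> f1; have [phi [phi1]] := exists_norming f.
move: phi1; have [z ->] := reflexivity phi; rewrite norm_eval_at eval_atE f1.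
move=> z1 fz; exists z; split=> //; apply/eqP; rewrite eq_le z1/=.
by rewrite -fz (le_trans (dual_le f z))// f1 mul1r.
Qed.

End Bidual.

(** * Exposed points and smooth functionals *)

Section Exposed.
Context {R : realType} (Z : finNormedModType R).
Implicit Types (F : dual_space Z) (z w : Z).

(** [F] exposes [z] when, over the unit ball, it takes its maximum value 1 at
    [z] and nowhere else. *)
Definition exposes F z : Prop :=
  [/\ `|z| <= 1, F z = 1 :> R & forall w, `|w| <= 1 ->
     (F w : R) <= 1 /\ (F w = 1 :> R -> w = z)].

Lemma exposes_norm F z : exposes F z -> `|F| = 1 /\ `|z| = 1.
Proof.
case=> z1 Fz Fz1.
have F1 : `|F| <= 1 by apply: dual_norm_le_ball => w /Fz1 [].
have := dual_le F z; rewrite Fz => h; have F0 := normr_ge0 F.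
have z0 := normr_ge0 z; split; apply/eqP; rewrite eq_le ?F1 ?z1/=.
  by rewrite (le_trans h)// ler_piMr.
by rewrite (le_trans h)// ler_piMl.
Qed.

Lemma smooth_dualP F : smooth_points (dual_space Z) F <-> exists z, exposes F z.
Proof.
split=> [[F1 [phi [[phi1 phiF] uphi]]]|[z Fz]].
  rewrite /unit_sphere/= in F1 phi1.
  have [z phiz] := reflexivity phi.
  have z1 : `|z| = 1 by rewrite -norm_eval_at -phiz.
  exists z; split=> [||w w1]; first by rewrite z1.
    by rewrite -eval_atE -phiz.
  have Fw := dual_le F w; rewrite F1 mul1r in Fw.
  split=> [|Fw1]; first exact: le_trans w1.
  apply/eval_at_inj; rewrite -phiz; apply/esym/uphi; split; last first.
    by rewrite eval_atE.
  by rewrite /unit_sphere/= norm_eval_at; apply/eqP; rewrite eq_le w1/= -{1}Fw1.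
have [F1 z1] := exposes_norm Fz; case: Fz => _ Fz1 Fz.
split=> //; exists (eval_at z); split.
  by rewrite /unit_sphere/= norm_eval_at eval_atE.
move=> phi; have [w ->] := reflexivity phi.
rewrite /unit_sphere/= norm_eval_at eval_atE => -[w1 Fw].
by have [|_ ->] := Fz w; rewrite ?w1.
Qed.

Lemma exposes_extreme F z : exposes F z -> extreme_points (unit_ball Z) z.
Proof.
case=> z1 Fz Fz1; split=> // a b t a1 b1 /andP[t0 t1] zab.
have [Fa Fa1] := Fz1 a a1; have [Fb Fb1] := Fz1 b b1.
have h : t * F a + (1 - t) * F b = 1 by rewrite -[RHS]Fz zab linearD !linearZ.
have ta : t * F a <= t by rewrite ler_piMr// ltW.
have tb : (1 - t) * F b <= 1 - t by rewrite ler_piMr// subr_ge0 ltW.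
split; [apply: Fa1; have u0 := t0|apply: Fb1; have u0 : 0 < 1 - t by lra].
  by apply: (mulfI (lt0r_neq0 u0)); lra.
by apply: (mulfI (lt0r_neq0 u0)); lra.
Qed.

End Exposed.

(** * Polyhedral unit balls *)

Section Polyhedral.
Context {R : realType} (Z : finNormedModType R).
Implicit Types (F : dual_space Z) (z w v : Z).
Implicit Types (s : seq (dual_space Z * R)) (p : dual_space Z * R).

(** [v] belongs to the cone of directions that violate none of the constraints
    of [s] that are active at [z]. *)
Definition active_cone s z v : Prop :=
  forall p, p \in s -> p.1 z = p.2 -> (p.1 v : R) <= 0.

(** A direction in the active cone can be followed for a positive time without
    leaving the polyhedron; inactive constraints leave some room. *)
Lemma feasible_direction s z v : (forall p, p \in s -> p.1 z <= p.2) ->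
  active_cone s z v ->
  exists2 t : R, 0 < t & forall p, p \in s -> p.1 (z + t *: v) <= p.2.
Proof.
move=> zs vs.
(* The bound is required for all shorter times as well, so that minima can be
   taken along the list of constraints. *)
suff [t t0 tP] : exists2 t : R, 0 < t &
    forall t', 0 < t' <= t -> forall p, p \in s -> p.1 (z + t' *: v) <= p.2.
  by exists t => //; apply: tP; rewrite t0/=.
elim: s => [|p s IH] in zs vs *; first by exists 1.
have [||t t0 tP] := IH; first by move=> q qs; apply: zs; rewrite inE qs orbT.
  by move=> q qs; apply: vs; rewrite inE qs orbT.
have ps : p \in p :: s by rewrite inE eqxx.
have [r r0 rP] : exists2 r : R, 0 < r &
    forall t', 0 < t' <= r -> p.1 (z + t' *: v) <= p.2.
  have [pz|pz] := eqVneq (p.1 z : R) p.2.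
    exists 1 => // t' /andP[t'0 _]; rewrite linearD linearZ/=.
    have := vs _ ps pz; rewrite -pz gerDl => pv.
    by rewrite /GRing.scale/= pmulr_rle0.
  have pz' : p.1 z < p.2 by rewrite lt_neqAle pz zs.
  have c0 : 0 < `|p.1 v : R| + 1 by rewrite ltr_wpDl.
  exists ((p.2 - p.1 z) / (`|p.1 v : R| + 1)); first by rewrite divr_gt0// subr_gt0.
  move=> t' /andP[t'0]; rewrite ler_pdivlMr// mulrDr mulr1 => h.
  rewrite linearD linearZ/=.
  have : t' * p.1 v <= t' * `|p.1 v : R| by rewrite ler_pM2l// ler_norm.
  by rewrite /GRing.scale/=; lra.
exists (Num.min t r) => [|t' /andP[t'0]]; first by rewrite lt_min t0.
rewrite le_min => /andP[t't t'r] q; rewrite inE => /orP[/eqP ->|qs].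
  by apply: rP; rewrite t'0.
by apply: tP => //; rewrite t'0.
Qed.

Lemma polyhedralP : polyhedral Z -> exists s,
  forall w, `|w| <= 1 <-> (forall p, p \in s -> p.1 w <= p.2).
Proof. by case=> s sE; exists s => w; move/(congr1 (fun A => A w)): sE => /= <-. Qed.

(** The sum of the constraints active at an extreme point exposes it, up to
    normalization. The space is assumed nonzero, by means of [v], because the
    ball of the zero space has an extreme point but no functional of norm 1. *)
Lemma extreme_exposes z v : polyhedral Z -> v != 0 ->
  extreme_points (unit_ball Z) z -> exists F, exposes F z.
Proof.
move=> /polyhedralP[s sP] v0 [z1 zext].
pose G : dual_space Z := \sum_(p <- s | p.1 z == p.2) p.1.
have GE w : G w = \sum_(p <- s | p.1 z == p.2) (p.1 w : R) :> R.
  by rewrite /G sum_lfunE.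
have zs := (sP z).1 z1.
have Gle w : `|w| <= 1 -> (G w : R) <= G z.
  move=> /sP ws; rewrite !GE big_seq_cond [leRHS]big_seq_cond.
  by apply: ler_sum => p /andP[ps /eqP ->]; exact: ws.
have Geq w : `|w| <= 1 -> G w = G z :> R -> w = z.
  move=> w1 /esym/eqP; rewrite -subr_eq0 !GE -sumrB.
  rewrite big_seq_cond psumr_eq0 => [|p /andP[ps /eqP ->]]; last first.
    by rewrite subr_ge0 (sP w).1.
  move=> /allP act.
  (* If [w] satisfies the active constraints with equality, the segment from
     [w] to [z] can be prolonged beyond [z] inside the ball. *)
  have [|t t0 /sP b1] := @feasible_direction s z (z - w) zs.
    move=> p ps pz; have := act p ps; rewrite ps pz eqxx/= subr_eq0 => /eqP.
    by rewrite linearB/= -pz => ->; rewrite subrr.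
  have t1 : 0 < 1 + t by rewrite addr_gt0.
  have [||//] := zext w _ (t / (1 + t)) w1 b1.
    by rewrite divr_gt0//= ltr_pdivrMr// mul1r ltrDr.
  have -> : 1 - t / (1 + t) = (1 + t)^-1 by field; rewrite gt_eqF.
  apply: (scalerI (lt0r_neq0 t1)).
  rewrite scalerDr !scalerA mulfV ?gt_eqF// mulrCA mulfV ?gt_eqF//.
  rewrite scale1r mulr1 scalerBr scalerDl scale1r.
  by rewrite addrCA [t *: w + _]addrC subrK.
have Gz : 0 < (G z : R).
  rewrite lt_neqAle -{2}(linear0 G) Gle ?normr0// andbT; apply/eqP => Gz.
  (* By symmetry of the ball, a zero maximum makes [G] vanish on the ball, so
     that the ball is reduced to [z]. *)
  have G0 w : `|w| <= 1 -> w = z.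
    move=> w1; apply: Geq => //; apply/eqP; rewrite eq_le Gle//=.
    by have := Gle (- w); rewrite normrN linearN -Gz oppr_le0; exact.
  have := G0 (`|v|^-1 *: v); rewrite -(G0 0) ?normr0// normrZ normfV normr_id.
  rewrite mulVf ?normr_eq0// => /(_ (lexx _))/eqP.
  by rewrite scaler_eq0 invr_eq0 normr_eq0 orbb (negbTE v0).
exists ((G z : R)^-1 *: G); split=> // [|w w1].
  by rewrite dual_scaleE mulVf// gt_eqF.
rewrite dual_scaleE ler_pdivrMl// mulr1; split; first exact: Gle.
move=> /(congr1 (fun x => (G z : R) * x)); rewrite mulVKf ?gt_eqF// mulr1.
exact: Geq.
Qed.

End Polyhedral.

Section Perturbation.
Import VectorInternalTheory.
Context {R : realType} (Z : finNormedModType R).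
Implicit Types (f g : dual_space Z) (z w v : Z).
Implicit Types (s : seq (dual_space Z * R)) (p : dual_space Z * R).

Lemma continuous_dual_r2v f :
  continuous (fun u : 'rV[R]_(dim Z) => f (r2v u) : R).
Proof.
have -> : (fun u : 'rV[R]_(dim Z) => f (r2v u) : R) =
    (fun u => \sum_(i < dim Z) u 0 i * (f (r2v (delta_mx 0 i)) : R)).
  apply/funext => u; rewrite {1}(row_sum_delta u) !linear_sum/=.
  by apply: eq_bigr => i _; rewrite !linearZ.
apply: continuous_big => [|i _]; first exact: add_continuous.
move=> u; apply: (@continuousM R _ (fun u : 'rV[R]_(dim Z) => u 0 i)
  (fun=> f (r2v (delta_mx 0 i)) : R) u); first exact: coord_continuous.
exact: cst_continuous.
Qed.

(** If [f] is negative on the cone minus its vertex, a small perturbation of [f]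
    is still nonpositive there, because [f] is bounded away from 0 and [g] is
    bounded on a compact base of the cone. *)
Lemma active_cone_perturb s z f g :
  (forall v, active_cone s z v -> v != 0 -> (f v : R) < 0) ->
  exists2 e : R, 0 < e & forall v, active_cone s z v -> f v - e * g v <= 0.
Proof.
move=> fneg.
pose S := [set u : 'rV[R]_(dim Z) | `|u| = 1].
(* [K] is a base of the cone in coordinates, normalized by the sup norm of the
   coordinates rather than by the norm of [Z]; its compactness is immediate. *)
pose K := S `&` [set u | active_cone s z (r2v u)].
have normalize v : active_cone s z v -> v != 0 ->
    exists2 c : R, 0 < c & K (c *: v2r v).
  move=> vs v0; have nv : 0 < `|v2r v|.
    rewrite normr_gt0; apply: contra v0 => /eqP /(congr1 r2v).
    by rewrite v2rK linear0 => ->.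
  exists `|v2r v|^-1; first by rewrite invr_gt0.
  split; first by rewrite /S/= normrZ normfV normr_id mulVf ?gt_eqF.
  move=> p ps pz; rewrite !linearZ/= v2rK.
  by rewrite /GRing.scale/= pmulr_rle0 ?invr_gt0//; exact: vs.
have [K0|/set0P Kn0] := eqVneq K set0.
  exists 1 => // v vs; have [->|v0] := eqVneq v 0.
    by rewrite !linear0 mulr0 subrr.
  by have [c _] := normalize v vs v0; rewrite K0.
have compactK : compact K.
  apply: bounded_closed_compact.
    by exists 1; split=> // M /ltW M1 u [] /= ->.
  apply: closedI.
    rewrite (_ : S = Num.norm @^-1` [set 1 : R])//.
    by apply: closed_comp => [u _|]; [exact: norm_continuous|exact: closed_eq].
  rewrite (_ : mkset _ = \bigcap_(p in [set p | p \in s /\ p.1 z = p.2])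
      ((fun u => p.1 (r2v u) : R) @^-1` [set x | x <= 0])); last first.
    by apply/seteqP; split=> u us p; [case=> *; exact: us|move=> *; exact: us].
  apply: closed_bigI => p _; apply: closed_comp => [u _|]; last exact: closed_le.
  exact: continuous_dual_r2v.
have [k /set_mem[k1 ks] kmax] := compact_EVT_max Kn0 compactK
  (continuous_subspaceT (@continuous_dual_r2v f)).
have [m _ mmax] := compact_EVT_max Kn0 compactK
  (continuous_subspaceT (@continuous_dual_r2v (- g))).
have fk : (f (r2v k) : R) < 0.
  apply: fneg => //; apply/eqP => /(congr1 v2r); rewrite r2vK linear0 => k0.
  by move: k1; rewrite /S/= k0 normr0 => /esym/eqP; rewrite oner_eq0.
(* [f <= f (r2v k) < 0] and [- g <= M] on the base, so it is enough that
   the perturbation be at most [- f (r2v k) / M]; adding 1 avoids a null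
   denominator. *)
pose M : R := `|(- g) (r2v m) : R|.
have M0 : 0 < M + 1 by rewrite ltr_wpDl// normr_ge0.
pose e : R := - f (r2v k) / (M + 1).
have e0 : 0 < e by rewrite divr_gt0// oppr_gt0.
exists e => // v vs.
have [->|v0] := eqVneq v 0; first by rewrite !linear0 mulr0 subrr.
have [c c0 /mem_set Kv] := normalize v vs v0.
have kv : c * f v <= f (r2v k).
  by have := kmax _ Kv; rewrite linearZ/= v2rK linearZ.
have gM : c * - (g v : R) <= M.
  have := mmax _ Kv; rewrite linearZ/= v2rK linearZ/= opp_lfunE => mv.
  exact: le_trans mv (ler_norm _).
have eM : e * (c * - (g v : R)) <= e * M by rewrite ler_pM2l.
have fkE : f (r2v k) = - (e * (M + 1)) :> R.
  by rewrite divfK ?opprK// gt_eqF.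
rewrite -(pmulr_rle0 _ c0) mulrBr mulrCA.
rewrite fkE mulrDr mulr1 in kv; rewrite !mulrN in eM.
lra.
Qed.

(** For small [e > 0], the functional [f - e g] is still maximal at [z] on the
    unit ball. *)
Lemma exposes_perturb f g z : polyhedral Z -> exposes f z ->
  exists2 e : R, 0 < e &
    forall w, `|w| <= 1 -> f w - e * g w <= 1 - e * g z.
Proof.
move=> /polyhedralP[s sP] [z1 fz fz1]; have zs := (sP z).1 z1.
have [v vs v0|e e0 eP] := @active_cone_perturb s z f g.
  have [t t0 /sP /fz1] := feasible_direction zs vs.
  rewrite linearD linearZ/= fz => -[].
  rewrite -lerBrDl subrr pmulr_rle0// => fv0 fv.
  rewrite lt_neqAle fv0 andbT; apply: contra v0 => /eqP fv'.
  move: fv; rewrite fv' /GRing.scale/= mulr0 addr0.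
  move=> /(_ erefl)/eqP; rewrite -subr_eq0 addrAC subrr add0r scaler_eq0.
  by rewrite gt_eqF.
exists e => // w w1; have := eP (w - z).
rewrite !linearB/= fz; move=> h.
suff : f w - 1 - e * (g w - g z) <= 0 by lra.
apply: h => p ps pz; rewrite linearB/= pz subr_le0.
exact: (sP w).1.
Qed.

End Perturbation.

(** * Restriction to a subspace *)

Section Restriction.
Context {R : realType} (X : finNormedModType R) (Y : {vspace X}).

Lemma dual_restrictE (F : dual_space X) (y : subvs_of Y) :
  dual_restrict Y F y = F (vsval y) :> R.
Proof. by rewrite /dual_restrict comp_lfunE lfunE. Qed.

Lemma polyhedral_subspace : polyhedral X -> polyhedral (subvs_of Y).
Proof.
case=> s sE; exists [seq (dual_restrict Y p.1, p.2) | p <- s].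
apply/seteqP; split=> y /=.
  move=> y1 _ /mapP[p ps ->]/=; rewrite dual_restrictE.
  by have : unit_ball X (vsval y) by []; rewrite sE; apply.
move=> ys; suff : unit_ball X (vsval y) by [].
rewrite sE => p ps; have := ys _ (map_f _ ps).
by rewrite /= dual_restrictE.
Qed.

Lemma hahn_banach_subspace (f : dual_space (subvs_of Y)) (c : R) : 0 <= c ->
  (forall y, (f y : R) <= c * `|y|) ->
  exists F : dual_space X,
    dual_restrict Y F = f /\ (forall x, (F x : R) <= c * `|x|).
Proof.
move=> c0 fc.
pose f' : dual_space X := (f \o linfun (vsproj Y))%VF.
have f'E x : f' x = f (vsproj Y x) :> R by rewrite comp_lfunE lfunE.
have [x xY|F [Ff Fc]] := @hahn_banach _ _ f' c Y c0.
  by rewrite f'E (le_trans (fc _))// [X in c * X]/Num.norm/= vsprojK.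
exists F; split=> //; apply/lfunP => y.
by rewrite dual_restrictE Ff ?subvsP// f'E vsvalK.
Qed.

(** A norm-one restriction of a functional exposing [x] attains its norm, and
    can do so only at [x]; hence it exposes [x] in the subspace. *)
Lemma exposes_restrict (F : dual_space X) x : exposes F x ->
  `|dual_restrict Y F| = 1 ->
  exists2 y, vsval y = x & exposes (dual_restrict Y F) y.
Proof.
move=> [x1 Fx Fx1] /norm_attained[y [y1 Fy]].
have y1' : `|y| <= 1 by rewrite y1.
have yx : vsval y = x by apply: (Fx1 _ y1').2; rewrite -dual_restrictE.
exists y => //; split=> // w w1.
have [Fw Fw1] := Fx1 (vsval w) w1.
by rewrite dual_restrictE; split=> // /Fw1; rewrite -yx => /val_inj.
Qed.

End Restriction.

(** * Smooth functionals on a subspace and its extreme points *)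

Theorem corollary1p4 (R : realType) (X : finNormedModType R) (Y : {vspace X})
    (Y_neq0 : Y != 0%VS) (X_polyhedral : polyhedral X) :
  smooth_points (dual_space (subvs_of Y)) =
    [set f : dual_space (subvs_of Y) | exists F : dual_space X,
       [/\ f = dual_restrict Y F, smooth_points (dual_space X) F & `|dual_restrict Y F| = 1]]
  <->
  vsval @` extreme_points (unit_ball (subvs_of Y)) `<=` extreme_points (unit_ball X).
Proof.
have Y_polyhedral : polyhedral (subvs_of Y) by exact: polyhedral_subspace.
have [v0 v0_neq0] : exists v : subvs_of Y, v != 0.
  exists (vsproj Y (vpick Y)); apply: contraNneq Y_neq0 => /(congr1 vsval).
  by rewrite vsprojK ?memv_pick// => pick0; rewrite -vpick0; exact/eqP.
have v0X : vsval v0 != 0.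
  by apply: contraNneq v0_neq0 => v00; apply/eqP; exact: val_inj.
split=> [smoothE _ [y y_ext <-]|ext_sub].
  have [f fy] := extreme_exposes Y_polyhedral v0_neq0 y_ext.
  have : smooth_points (dual_space (subvs_of Y)) f.
    by apply/smooth_dualP; exists y.
  rewrite smoothE => -[F [fF /smooth_dualP[x Fx] F1]].
  have [y' y'x fy'] := exposes_restrict Fx F1.
  suff -> : y = y' by rewrite y'x; exact: exposes_extreme Fx.
  case: fy => y1 fy _; case: fy' => _ _ fy'.
  by apply: (fy' _ _).2 => //; rewrite -fF.
apply/seteqP; split=> [f /[dup] -[f1 _] /smooth_dualP[y fy]|_ /= [F [-> Fs F1]]].
  have y_ext := exposes_extreme fy.
  have [|G Gy] := extreme_exposes X_polyhedral v0X (z := vsval y).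
    by apply: ext_sub; exists y.
  have [e e0 fe] := exposes_perturb (dual_restrict Y G) Y_polyhedral fy.
  case: Gy => [y1 Gy Gy1]; rewrite dual_restrictE Gy mulr1 in fe.
  (* At 0 the perturbed functional vanishes, hence its maximum [1 - e] is
     nonnegative. *)
  have e1 : 0 <= 1 - e.
    by have := fe 0; rewrite normr0 !linear0 mulr0 subrr; exact.
  have [w|H [Hf Hle]] := @hahn_banach_subspace _ _ Y
      (f + (- e) *: dual_restrict Y G) (1 - e) e1.
    apply: dual_ball_le => {}w w1.
    by rewrite dual_addE dual_scaleE mulNr; exact: fe.
  (* On the ball, [H <= 1 - e] and [e * G <= e], so the sum equals 1 only where
     [G] equals 1. *)
  exists (H + e *: G).
  have Ff : f = dual_restrict Y (H + e *: G).
    apply/lfunP => w; rewrite dual_restrictE dual_addE dual_scaleE.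
    rewrite -dual_restrictE Hf dual_addE dual_scaleE dual_restrictE.
    by rewrite mulNr subrK.
  split=> //; last by rewrite -Ff; exact: f1.
  apply/smooth_dualP; exists (vsval y); case: fy => _ fy _.
  split=> // [|w w1]; first by rewrite -dual_restrictE -Ff.
  have [Gw Gw1] := Gy1 w w1; rewrite dual_addE dual_scaleE.
  have Hw : H w <= 1 - e by rewrite (le_trans (Hle w))// ler_piMr.
  have eGw : e * G w <= e by rewrite ler_piMr// ltW.
  split=> [|Fw]; first by lra.
  by apply: Gw1; apply: (mulfI (lt0r_neq0 e0)); lra.
apply/smooth_dualP; move/smooth_dualP: Fs => [x Fx].
by have [y _ fy] := exposes_restrict Fx F1; exists y.
Qed.
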